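(* Let $A$ be a nonempty closed class of decision tables from $\mathcal{M}_k^2$ for which the function $S$ is not bounded from above. Then $G_{h,A}(n)=n$ for every $n\in\omega$.
   Context: Fix an integer $k\ge 2$; $\omega=\{0,1,2,\ldots\}$, $E_k=\{0,1,\ldots,k-1\}$, $E_2=\{0,1\}$. Let $P=\{f_i:i\in\omega\}$ be a set of attribute names ($f_i\ne f_j$ for $i\ne j$). $\mathcal{M}_k^2$ is the set of rectangular tables filled with numbers from $E_k$ whose columns are labeled with pairwise different attributes from $P$, whose rows are pairwise different, and in which each row is labeled with a decision from $E_2$. Tables without rows also belong to $\mathcal{M}_k^2$ and are all denoted $\Lambda$. Tables differing only by a permutation of rows are equal. $P(T)$ is the set of column attributes. $\mathcal{M}_k^2\mathcal{C}$ is the set of tables in which all rows have the same decision ($\Lambda$ included). $T(f_{i_1},\delta_1)\cdots(f_{i_m},\delta_m)$ is the table of rows of $T$ having values $\delta_1,\ldots,\delta_m$ in the columns labeled $f_{i_1},\ldots,f_{i_m}$. Operations: for $D\subseteq P(T)$, $I(D,T)$ deletes the columns labeled by $D$ and, in each group of rows coinciding on the remaining columns, keeps one row with the minimum decision; $I(P(T),T)=\Lambda$. For $\nu:E_k^{|P(T)|}\to E_2$, $J(\nu,T)$ replaces the decision of each row $\bar\delta$ by $\nu(\bar\delta)$. $[T]=\{J(\nu,I(D,T)):D\subseteq P(T),\nu:E_k^{|P(T)\setminus D|}\to E_2\}$; $[A]=\bigcup_{T\in A}[T]$; nonempty $A$ is a closed class if $[A]=A$. A $k$-decision tree: finite directed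 rooted tree with at least two nodes, root and its leaving edges unlabeled, terminal nodes labeled with decisions from $E_2$, other nodes labeled with attributes from $P$ whose leaving edges are labeled with numbers from $E_k$; $P(\Gamma)$ is the set of attributes at nodes. For a complete path $\tau=v_1,d_1,\ldots,v_m,d_m,v_{m+1}$ (root to terminal node), $T(\tau)=T$ if $m=1$, else $T(f_{i_2},\delta_2)\cdots(f_{i_m},\delta_m)$ where $v_j$ is labeled $f_{i_j}$ and $d_j$ is labeled $\delta_j$. The depth $h(\Gamma)$ is the maximum over complete paths of $m-1$. For $T\notin\mathcal{M}_k^2\mathcal{C}$, a strongly nondeterministic decision tree for $T$: all terminal nodes labeled $1$, $P(\Gamma)\subseteq P(T)$, every row with decision $1$ lies in some $T(\tau)$, and for every complete path either $T(\tau)=\Lambda$ or all rows of $T(\tau)$ have decision $1$. For $T\ne\Lambda$: $h^s(T)=0$ if $T\in\mathcal{M}_k^2\mathcal{C}$, otherwise the minimum depth of a strongly nondeterministic decision tree for $T$; $W(T)$ is the number of columns; for a row $\bar\delta$, $S(T,\bar\delta)$ is the minimum cardinality of $D\subseteq P(T)$ such that on the columns labeled by $D$ the row $\bar\delta$ differs from all other rows, and $S(T)=\max_{\bar\delta}S(T,\bar\delta)$; all are $0$ on $\Lambda$. $G_{h,A}(n)=\max\{h^s(T):T\in A,W(T)\le n\}$. *)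

(* Defs.v *)
From HB Require Import structures.
From mathcomp Require Import all_boot all_order.
From mathcomp Require Import finmap.
From mathcomp Require Import boolp classical_sets.

Set Implicit Arguments.
Unset Strict Implicit.
Unset Printing Implicit Defensive.

Local Open Scope nat_scope.
Local Open Scope fset_scope.
Local Open Scope fmap_scope.
Local Open Scope classical_set_scope.

(* The value 0 is returned when X has no least (resp. greatest) element; the
   lemmas hs_attained, Srow_attained and Gh_attained show that this never
   happens where min_nat and max_nat are used. *)
Definition min_nat (X : set nat) : nat :=
  xget 0 [set m | X m /\ forall x, X x -> m <= x].

Definition max_nat (X : set nat) : nat :=
  xget 0 [set m | X m /\ forall x, X x -> x <= m].

(* The attribute f_i is represented by i : nat, E_k by 'I_k and E_2 by 'I_2,
   whose elements 0 and 1 are ord0 and ord_max.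
   A table is its list of column labels together with the finite map sending
   each row to its decision; hence rows are pairwise different and their order
   is irrelevant.  The last condition makes Lambda the only table without rows;
   it also excludes a nonempty table without columns, so that deleting all the
   columns of a table yields Lambda. *)
Definition table_ok (k : nat) (cm : seq nat * {fmap seq 'I_k -> 'I_2}) : bool :=
  [&& uniq cm.1,
      all (fun r : seq 'I_k => size r == size cm.1) (domf cm.2)
    & (cm.1 == [::]) == (domf cm.2 == fset0)].

Record table (k : nat) := Table {
  table_val : seq nat * {fmap seq 'I_k -> 'I_2};
  table_okP : table_ok table_val }.

HB.instance Definition _ (k : nat) := [isSub for @table_val k].

Section Tables.
Variable k : nat.
Implicit Types (T : table k) (r : seq 'I_k) (D : {fset nat}).

Definition cols T : seq nat := (table_val T).1.
Definition decs T : {fmap seq 'I_k -> 'I_2} := (table_val T).2.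
Definition rows T : {fset seq 'I_k} := domf (decs T).

Definition attrs T : {fset nat} := [fset i in cols T].
Definition W T : nat := size (cols T).

Fact Lambda_ok : table_ok ([::], [fmap] : {fmap seq 'I_k -> 'I_2}).
Proof.
by apply/and3P; split=> //=; rewrite ?eqxx //; apply/allP=> r; rewrite in_fset0.
Qed.

Definition Lambda : table k := Table Lambda_ok.

(* In the uses below the data fail table_ok only when there are no rows or no
   columns. *)
Definition mk_table (c : seq nat) (m : {fmap seq 'I_k -> 'I_2}) : table k :=
  insubd Lambda (c, m).

(* M_k^2 C *)
Definition const_table T : bool :=
  [forall r : rows T, [forall r' : rows T, decs T r == decs T r']].

(* The value of the row r in the column labeled i (None if i is not in attrs T). *)
Definition value T r (i : nat) : option 'I_k := onth r (index i (cols T)).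

Definition subtable T (w : seq (nat * 'I_k)) : table k :=
  mk_table (cols T)
    (decs T).[& [fset r in rows T | all (fun x => value T r x.1 == Some x.2) w]].

Definition proj D T r : seq 'I_k := mask [seq i \notin D | i <- cols T] r.

Definition I_op D T : table k :=
  mk_table [seq i <- cols T | i \notin D]
    [fmap r : [fset proj D T r' | r' in rows T] =>
       \big[Order.min/ord_max]_(r' : rows T | proj D T (val r') == val r)
          decs T r'].

(* insub never fails here: the rows of T have length W T. *)
Definition J_op T (nu : (W T).-tuple 'I_k -> 'I_2) : table k :=
  mk_table (cols T) [fmap r : rows T => oapp nu ord0 (insub (val r))].

Definition closure1 T : set (table k) :=
  [set T' | exists2 D : {fset nat}, (D `<=` attrs T)%fset &
            exists nu : (W (I_op D T)).-tuple 'I_k -> 'I_2, T' = J_op nu].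

Definition closure_op (A : set (table k)) : set (table k) :=
  \bigcup_(T in A) closure1 T.

Definition closed_class (A : set (table k)) : Prop :=
  A !=set0 /\ closure_op A = A.

Definition separates T r D : Prop :=
  forall r', r' \in rows T -> r' != r ->
    exists2 i, i \in D & value T r i != value T r' i.

Definition Srow T r : nat :=
  min_nat [set #|` D| | D in [set D | (D `<=` attrs T)%fset /\ separates T r D]].

Definition Smax T : nat := \max_(r <- rows T) Srow T r.

End Tables.

(* The subtrees hanging below the root: a node labeled with an attribute has at
   least one leaving edge (hence the separate first edge); several leaving edges
   may carry the same label. *)
Inductive dnode (k : nat) : Type :=
| Term of 'I_2
| Work of nat & 'I_k * dnode k & seq ('I_k * dnode k).

(* The root has at least one leaving edge, as a tree has at least two nodes. *)
Inductive dtree (k : nat) : Type := Root of dnode k & seq (dnode k).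

Section Trees.
Variable k : nat.

Fixpoint node_attrs (v : dnode k) : seq nat :=
  match v with
  | Term _ => [::]
  | Work i e es => i :: node_attrs e.2 ++ flatten [seq node_attrs x.2 | x <- es]
  end.

Definition tree_attrs (Gam : dtree k) : seq nat :=
  let: Root v vs := Gam in flatten [seq node_attrs x | x <- v :: vs].

(* A complete path is given by the word (f_{i_2}, delta_2) ... (f_{i_m}, delta_m)
   read along it and by the label of its terminal node. *)
Definition cpath : Type := (seq (nat * 'I_k) * 'I_2)%type.

Fixpoint node_paths (v : dnode k) : seq cpath :=
  match v with
  | Term d => [:: ([::], d)]
  | Work i e es =>
      let ext (x : 'I_k * dnode k) :=
        [seq ((i, x.1) :: p.1, p.2) | p <- node_paths x.2] in
      ext e ++ flatten [seq ext x | x <- es]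
  end.

Definition tree_paths (Gam : dtree k) : seq cpath :=
  let: Root v vs := Gam in flatten [seq node_paths x | x <- v :: vs].

Definition depth (Gam : dtree k) : nat := \max_(p <- tree_paths Gam) size p.1.

Definition sn_tree (T : table k) (Gam : dtree k) : Prop :=
  [/\ forall p, p \in tree_paths Gam -> p.2 = ord_max,
      {subset tree_attrs Gam <= attrs T},
      forall r, (decs T).[? r] = Some ord_max ->
        exists2 p, p \in tree_paths Gam & r \in rows (subtable T p.1)
    & forall p, p \in tree_paths Gam ->
        subtable T p.1 = Lambda k \/
        forall r, r \in rows (subtable T p.1) ->
          (decs (subtable T p.1)).[? r] = Some ord_max].

Definition hs (T : table k) : nat :=
  if const_table T then 0 else min_nat [set depth Gam | Gam in sn_tree T].

Definition Gh (A : set (table k)) (n : nat) : nat :=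
  max_nat [set hs T | T in [set T | A T /\ W T <= n]].

End Trees.

Lemma min_natP (X : set nat) :
  X !=set0 -> X (min_nat X) /\ forall x, X x -> min_nat X <= x.
Proof.
move=> [x0 Xx0]; rewrite /min_nat.
have exX : exists n, `[< X n >] by exists x0; apply/asboolP.
case: (ex_minnP exX) => m /asboolP Xm minm.
apply: (@xgetI _ 0 [set m | X m /\ forall x, X x -> m <= x] m).
by split=> // x Xx; apply: minm; apply/asboolP.
Qed.

Lemma max_natP (X : set nat) (b : nat) :
  X !=set0 -> (forall x, X x -> x <= b) ->
  X (max_nat X) /\ forall x, X x -> x <= max_nat X.
Proof.
move=> [x0 Xx0] leXb; rewrite /max_nat.
have exX : exists n, `[< X n >] by exists x0; apply/asboolP.
have bX : forall n, `[< X n >] -> n <= b by move=> n /asboolP; exact: leXb.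
case: (ex_maxnP exX bX) => m /asboolP Xm maxm.
apply: (@xgetI _ 0 [set m | X m /\ forall x, X x -> x <= m] m).
by split=> // x Xx; apply: maxm; apply/asboolP.
Qed.

Section WellDefined.
Variable k : nat.
Implicit Types (T : table k) (r : seq 'I_k) (D : {fset nat}).

Lemma table_inj T T' : cols T = cols T' -> decs T = decs T' -> T = T'.
Proof.
move=> ec ed; apply: val_inj => /=.
rewrite [table_val T]surjective_pairing [table_val T']surjective_pairing.
by congr pair.
Qed.

Lemma cols_uniq T : uniq (cols T).
Proof. by case/and3P: (table_okP T). Qed.

Lemma rows_size T r : r \in rows T -> size r = W T.
Proof. by case/and3P: (table_okP T) => _ /allP h _ /h /eqP. Qed.

Lemma cols_nil T : (cols T == [::]) = (rows T == fset0).
Proof. by case/and3P: (table_okP T) => _ _ /eqP. Qed.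

Lemma mem_attrs T i : (i \in attrs T) = (i \in cols T).
Proof. by rewrite !inE. Qed.

Lemma Lambda_uniq T : rows T = fset0 -> T = Lambda k.
Proof.
move=> r0; have := cols_nil T; rewrite r0 eqxx => /eqP c0.
by apply: table_inj; [rewrite c0 | apply: fmap_nil].
Qed.

Lemma J_opE T (nu : (W T).-tuple 'I_k -> 'I_2) :
  cols (J_op nu) = cols T /\
  decs (J_op nu) = [fmap r : rows T => oapp nu ord0 (insub (val r))].
Proof.
rewrite /cols /decs /J_op /mk_table /insubd insubT //=.
exact: table_okP T.
Qed.

Lemma subtableE T w (m := (decs T).[&
    [fset r in rows T | all (fun x => value T r x.1 == Some x.2) w]]) :
  domf m != fset0 -> cols (subtable T w) = cols T /\ decs (subtable T w) = m.
Proof.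
move=> m0; have /and3P[uT /allP sT _] := table_okP T.
rewrite /cols /decs /subtable /mk_table /insubd insubT //=.
rewrite /table_ok /= uT /= (negPf m0) eqbF_neg; apply/andP; split.
  by apply/allP=> r; rewrite mem_restrictf => /andP[_ /sT].
apply: contra m0; rewrite -/(cols T) cols_nil => /eqP r0.
apply/eqP/fsetP => r; rewrite mem_restrictf.
have /= -> : (r \in decs T) = false by rewrite -[_ \in _]/(r \in rows T) r0 inE.
by rewrite andbF.
Qed.

Lemma mk_table0 (c : seq nat) (m : {fmap seq 'I_k -> 'I_2}) :
  domf m = fset0 -> rows (mk_table c m) = fset0.
Proof.
move=> m0; rewrite /rows /decs /mk_table /insubd.
by case: insubP => [T _ /= ->|].
Qed.

Lemma mem_subtable T w r :
  (r \in rows (subtable T w)) =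
  (r \in rows T) && all (fun x => value T r x.1 == Some x.2) w.
Proof.
set m := (decs T).[&
    [fset r in rows T | all (fun x => value T r x.1 == Some x.2) w]].
have mE : (r \in domf m) =
    (r \in rows T) && all (fun x => value T r x.1 == Some x.2) w.
  rewrite mem_restrictf !inE /= -[r \in decs T]/(r \in rows T).
  by case: (r \in rows T); rewrite /= ?andbT ?andbF.
rewrite -mE; have [m0|/subtableE[_ Em]] := eqVneq (domf m) fset0; last first.
  by rewrite /rows Em.
by rewrite m0 mk_table0.
Qed.

Lemma decs_subtable T w r : r \in rows (subtable T w) ->
  (decs (subtable T w)).[? r] = (decs T).[? r].
Proof.
move=> rw; have := rw; rewrite mem_subtable => /andP[rT rall].
have [|_ ->] := @subtableE T w.
  apply/fset0Pn; exists r; rewrite mem_restrictf !inE /=.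
  by rewrite rall andbT andbb.
by rewrite fnd_restrict !inE /= rT rall.
Qed.

Lemma I_opE D T (m := [fmap r : [fset proj D T r' | r' in rows T] =>
       \big[Order.min/ord_max]_(r' : rows T | proj D T (val r') == val r)
          decs T r']) :
  ~~ (attrs T `<=` D)%fset ->
  cols (I_op D T) = [seq i <- cols T | i \notin D] /\ decs (I_op D T) = m.
Proof.
move=> TD; rewrite /cols /decs /I_op /mk_table /insubd insubT //=.
rewrite /table_ok /= filter_uniq ?cols_uniq //=; apply/andP; split.
  apply/allP=> _ /imfsetP[r /= rT ->].
  by rewrite /proj size_mask ?size_map ?(rows_size rT) // size_filter count_map.
case/fsubsetPn: TD => i; rewrite mem_attrs => iT iD.
have iF : i \in [seq i <- cols T | i \notin D] by rewrite mem_filter iD.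
have -> : ([seq i <- cols T | i \notin D] == [::]) = false.
  by apply/eqP=> e; rewrite e in iF.
have : rows T != fset0.
  by rewrite -cols_nil; apply/eqP => e; rewrite e in iT.
case/fset0Pn => r rT; rewrite eq_sym eqbF_neg; apply/fset0Pn.
by exists (proj D T r); apply/imfsetP; exists r.
Qed.

Lemma I_op_all D T : (attrs T `<=` D)%fset -> I_op D T = Lambda k.
Proof.
move=> /fsubsetP TD; rewrite /I_op; have -> : [seq i <- cols T | i \notin D] = [::].
  apply/eqP; rewrite -[_ == _]negbK -has_filter; apply/hasPn => i iT.
  by rewrite negbK TD // mem_attrs.
apply: Lambda_uniq; rewrite /rows /decs /mk_table /insubd.
by case: insubP => [T' /and3P[_ _ /eqP/esym/eqP] /= + ->|_] //=; rewrite eqxx => /eqP.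
Qed.

Lemma onth_Some (d : 'I_k) r n : n < size r -> onth r n = Some (nth d r n).
Proof. by move=> nr; rewrite onthE (nth_map d). Qed.

Lemma row_ext T r r' : r \in rows T -> r' \in rows T ->
  (forall i, i \in cols T -> value T r i = value T r' i) -> r = r'.
Proof.
move=> /rows_size sr /rows_size sr' e; apply: eq_from_onth => n.
have [nT|nT] := ltnP n (W T); last by rewrite !onth_default ?sr ?sr'.
by have := e (nth 0 (cols T) n) (mem_nth _ nT); rewrite /value index_uniq ?cols_uniq.
Qed.

Lemma attrs_separates T r : r \in rows T -> separates T r (attrs T).
Proof.
move=> rT r' r'T nr.
have [/hasP[i iT ne]|/hasPn h] :=
  boolP (has (fun i => value T r i != value T r' i) (cols T)).
  by exists i; rewrite ?mem_attrs.
case/eqP: nr; apply: (@row_ext T) => // i /h; by rewrite negbK => /eqP.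
Qed.

Lemma Srow_attained T r : r \in rows T ->
  exists2 D : {fset nat}, [/\ (D `<=` attrs T)%fset, separates T r D & #|` D| = Srow T r] &
    forall D', (D' `<=` attrs T)%fset -> separates T r D' -> Srow T r <= #|` D'|.
Proof.
move=> rT; have [] := @min_natP
    [set #|` D| | D in [set D | (D `<=` attrs T)%fset /\ separates T r D]].
  by exists #|` attrs T|, (attrs T); split=> //; exact: attrs_separates.
move=> [D [DT sD] DS] minS; exists D; first by split.
by move=> D' D'T sD'; apply: minS; exists D'.
Qed.

Definition chain (w : seq (nat * 'I_k)) : dnode k :=
  foldr (fun x v => Work x.1 (x.2, v) [::]) (Term k ord_max) w.

Lemma chain_paths w : node_paths (chain w) = [:: (w, ord_max)].
Proof. by elim: w => //= [[i d] w] ->. Qed.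

Lemma chain_attrs w : node_attrs (chain w) = map fst w.
Proof. by elim: w => //= [[i d] w] ->; rewrite cats0. Qed.

Lemma sn_tree_exists T : ~~ const_table T ->
  exists2 Gam, sn_tree T Gam & depth Gam = W T.
Proof.
move=> nc.
pose R1 := [seq r <- rows T | (decs T).[? r] == Some ord_max].
pose rw (r : seq 'I_k) := zip (cols T) r.
have R1P r : r \in R1 = ((decs T).[? r] == Some ord_max).
  rewrite mem_filter andb_idr // => /eqP e.
  by rewrite /rows -fndSome e.
have ER1 : exists r R, R1 = r :: R.
  suff [r rR] : exists r, r \in R1 by case: (R1) rR => // r0 R _; exists r0, R.
  move: nc; rewrite /const_table negb_forall => /existsP[r].
  rewrite negb_forall => /existsP[r' nrr'].
  have Dd (x : rows T) : decs T x = ord_max \/ decs T x = ord0.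
    by case: (decs T x) => [[|[|//]] p]; [right|left]; apply: val_inj.
  case: (Dd r) => e; first by exists (val r); rewrite R1P -Some_fnd e.
  case: (Dd r') => e'; first by exists (val r'); rewrite R1P -Some_fnd e'.
  by rewrite e e' eqxx in nrr'.
have [r0 [R ER]] := ER1.
pose Gam := Root (chain (rw r0)) [seq chain (rw r) | r <- R].
have pE : tree_paths Gam = [seq (rw r, ord_max) | r <- R1].
  rewrite /= ER /= chain_paths /=; congr cons.
  by elim: (R) => //= r R' ->; rewrite chain_paths.
have rwP r r' : r \in rows T ->
    (r' \in rows (subtable T (rw r))) = (r' == r).
  move=> rT; rewrite mem_subtable; apply/andP/eqP => [[r'T /allP h]|->]; last first.
    split=> //; apply/allP => -[i d] /= idw.
    have [j [jlt]] : exists j, j < W T /\ (i, d) = (nth 0 (cols T) j, nth d r j).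
      move: idw => /(nthP (0, d))[j]; rewrite size_zip (rows_size rT) minnn => jl <-.
      by exists j; rewrite nth_zip ?(rows_size rT).
    case=> -> ->; rewrite /value index_uniq ?cols_uniq //.
    by rewrite (onth_Some d) ?(rows_size rT).
  apply: (@row_ext T) => // i iT.
  have jl : index i (cols T) < W T by rewrite index_mem.
  case: r rT h => [|d r1] rT h.
    by move: jl; rewrite -(rows_size rT).
  have := h (nth (0, d) (rw (d :: r1)) (index i (cols T))).
  rewrite mem_nth; last by rewrite size_zip (rows_size rT) minnn.
  move=> /(_ isT); rewrite nth_zip ?(rows_size rT) //= nth_index // => /eqP ->.
  by rewrite /value (onth_Some d) // (rows_size rT).
have R1T r : r \in R1 -> r \in rows T by rewrite mem_filter => /andP[].
exists Gam; last first.
  rewrite /depth pE big_map; apply/eqP; rewrite eqn_leq; apply/andP; split.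
    apply/bigmax_leqP_seq => r rR _ /=.
    by rewrite size_zip (rows_size (R1T _ rR)) minnn.
  have r0T : r0 \in rows T by apply: R1T; rewrite ER mem_head.
  by rewrite ER big_cons /= size_zip (rows_size r0T) minnn leq_maxl.
split.
- by move=> p; rewrite pE => /mapP[r _ ->].
- have aE : tree_attrs Gam = flatten [seq map fst (rw r) | r <- R1].
    rewrite /= ER /= chain_attrs; congr cat.
    by elim: (R) => //= r R' ->; rewrite chain_attrs.
  move=> i; rewrite aE mem_attrs => /flattenP[_ /mapP[r rR ->]].
  by rewrite -/(unzip1 _) unzip1_zip // (rows_size (R1T _ rR)).
- move=> r /eqP; rewrite -R1P => rR; exists (rw r, ord_max).
    by rewrite pE; apply/mapP; exists r.
  by rewrite rwP ?R1T.
- move=> p; rewrite pE => /mapP[r rR ->]; right => r' /= r'w.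
  rewrite decs_subtable //; move: r'w; rewrite rwP ?R1T // => /eqP ->.
  by apply/eqP; rewrite -R1P.
Qed.

Lemma hs_attained T : ~~ const_table T ->
  (exists2 Gam, sn_tree T Gam & depth Gam = hs T) /\
  forall Gam, sn_tree T Gam -> hs T <= depth Gam.
Proof.
move=> nc; rewrite /hs (negPf nc).
have [|[Gam sG dG] minG] := @min_natP [set depth Gam | Gam in sn_tree T].
  by have [Gam sG _] := sn_tree_exists nc; exists (depth Gam), Gam.
split; first by exists Gam.
by move=> Gam' sG'; apply: minG; exists Gam'.
Qed.

Lemma hs_leW T : hs T <= W T.
Proof.
have [c|nc] := boolP (const_table T); first by rewrite /hs c.
have [Gam sG <-] := sn_tree_exists nc.
by have [_] := hs_attained nc; apply.
Qed.

Lemma Lambda_closed (A : set (table k)) : closed_class A -> A (Lambda k).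
Proof.
move=> [[T AT] <-]; exists T => //; exists (attrs T) => //.
exists (fun=> ord0); apply/esym/Lambda_uniq.
have [_ e] := @J_opE (I_op (attrs T) T) (fun=> ord0).
by rewrite /rows e /= I_op_all // /rows.
Qed.

Lemma Gh_attained (A : set (table k)) (n : nat) : closed_class A ->
  (exists2 T, A T /\ W T <= n & hs T = Gh A n) /\
  forall T, A T -> W T <= n -> hs T <= Gh A n.
Proof.
move=> /Lambda_closed AL; rewrite /Gh.
have [||[T AT hT] maxG] := @max_natP [set hs T | T in [set T | A T /\ W T <= n]] n.
- by exists (hs (Lambda k)), (Lambda k).
- by move=> _ [T [_ WT] <-]; exact: leq_trans (hs_leW T) WT.
split; first by exists T.
by move=> T' AT' WT'; apply: maxG; exists T'.
Qed.

End WellDefined.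

(* Main.v *)
(** Let [D] be a minimum set of columns separating a row [r] from the other rows
    of a table of [A], and suppose that [D] has at least [n] elements.  By
    minimality, for each [i] in [D] some row differs from [r] on [D] in column
    [i] only.  Keeping just [n] columns of [D] therefore gives a table of width
    [n] in which [r] has a neighbour in every direction.  Give [r] the decision 1
    and all other rows the decision 0: a path of a strongly nondeterministic tree
    accepting [r] must then test every column. *)

Require Import Defs.
From mathcomp Require Import all_boot all_order.
From mathcomp Require Import finmap.
From mathcomp Require Import boolp classical_sets.

Lemma onth_mask_index (I : eqType) (X : Type) (p : pred I) (s : seq I)
    (t : seq X) (i : I) : size t = size s -> p i ->
  onth (mask [seq p j | j <- s] t) (index i [seq j <- s | p j]) =
  onth t (index i s).
Proof.
elim: s t => [|j s IHs] [|x t] //= [st] pi.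
have [ji|ji] := eqVneq j i; first by rewrite ji pi /= eqxx.
by case: (p j); rewrite /= ?(negPf ji) /= IHs.
Qed.

Section Neighbours.
Set Implicit Arguments.
Unset Strict Implicit.
Variable k : nat.
Implicit Types (T : table k) (r : seq 'I_k) (D : {fset nat}).

(** Agreement with [r] is required only on [D]: the condition then passes to subsets of [D], and it
    survives the deletion of all columns outside [D]. *)
Definition has_neighbours T r D : Prop :=
  forall i, i \in D -> exists r', [/\ r' \in rows T,
    value T r' i <> value T r i &
    forall j, j \in D -> j != i -> value T r' j = value T r j].

Lemma has_neighboursS T r D D' :
  (D' `<=` D)%fset -> has_neighbours T r D -> has_neighbours T r D'.
Proof.
move=> /fsubsetP DD nD i /DD /nD[r' [r'T ne e]].
by exists r'; split=> // j /DD; exact: e.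
Qed.

Lemma Srow_neighbours T r : r \in rows T ->
  exists D, [/\ (D `<=` attrs T)%fset, #|` D|%fset = Srow T r &
                has_neighbours T r D].
Proof.
move=> rT; have [D [DT sD cD] minD] := Srow_attained rT.
exists D; split=> // i iD; apply: contrapT => no.
(* Without a neighbour in direction [i], [D] minus [i] would still separate [r], against the
   minimality of [D]. *)
suff /minD : separates T r (D `\ i)%fset.
  move=> /(_ (fsubset_trans (fsubD1set D i) DT)).
  by rewrite -cD (cardfsD1 i D) iD ltnn.
move=> r' r'T r'r; apply: contrapT => no'.
have e j : j \in D -> j != i -> value T r' j = value T r j.
  move=> jD ji; apply/esym/eqP/negP => /negP ne.
  by apply: no'; exists j => //; rewrite in_fsetD1 ji.
(* The row [r'] agrees with [r] on [D] away from [i], so the column of [D] that tells them apart can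
   only be [i]. *)
have [j jD ne] := sD r' r'T r'r.
apply: no; exists r'; split=> // ei.
have [ji|ji] := eqVneq j i; first by rewrite ji ei eqxx in ne.
by rewrite e // eqxx in ne.
Qed.

Lemma Smax_neighbours T n : n < Smax T ->
  exists r D, [/\ r \in rows T, (D `<=` attrs T)%fset, #|` D|%fset = n &
                  has_neighbours T r D].
Proof.
(* The strict inequality provides a row even for [n = 0], where [n <= Smax T] would also hold for
   [Lambda]. *)
move=> nS; have [r rT nr] : exists2 r, r \in rows T & n < Srow T r.
  apply: contrapT => no; have : Smax T <= n; last by rewrite leqNgt nS.
  apply/bigmax_leqP_seq => r rT _; rewrite leqNgt.
  by apply/negP => nr; apply: no; exists r.
have [D [DT cD nD]] := Srow_neighbours rT.
have uD : uniq (take n D) by rewrite take_uniq // fset_uniq.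
pose D' := [fset i in take n D]%fset.
have sD : (D' `<=` D)%fset.
  by apply/fsubsetP => i; rewrite in_fset => /mem_take.
exists r, D'; split=> //; first exact: fsubset_trans DT.
  by rewrite card_fseq undup_id // size_take cD nr.
exact: has_neighboursS nD.
Qed.

Lemma value_proj T r D i : r \in rows T -> i \notin D ->
  ~~ (attrs T `<=` D)%fset ->
  value (I_op D T) (proj D T r) i = value T r i.
Proof.
move=> rT iD TD; have [ec _] := I_opE TD.
by rewrite /value ec onth_mask_index // (rows_size rT).
Qed.

(** If a path accepting [r] skipped column [i], the neighbour of [r] in direction [i] would follow
    the same path, though its decision is not 1. *)
Lemma W_le_hs T r : 0 < W T -> r \in rows T ->
  (forall r', ((decs T).[? r'] = Some ord_max)%fmap <-> r' = r) ->
  has_neighbours T r (attrs T) -> W T <= hs T.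
Proof.
move=> W0 rT dT nT.
have neq i r' : value T r' i <> value T r i -> r' <> r by move=> ne e; rewrite e in ne.
have nc : ~~ const_table T.
  have [i iT] : exists i, i \in attrs T.
    by exists (nth 0 (cols T) 0); rewrite mem_attrs mem_nth.
  have [r' [r'T /neq r'r _]] := nT i iT.
  apply/negP => /forallP /(_ [` rT]%fset) /forallP /(_ [` r'T]%fset) /eqP e.
  apply/r'r/dT; rewrite (in_fnd r'T) -e.
  by have /dT := erefl r; rewrite (in_fnd rT).
have [[Gam [_ _ cov acc] <-] _] := hs_attained nc.
have [p pG rp] := cov r ((dT r).2 erefl).
have /acc[e|one] := pG; first by move: rp; rewrite e.
have sub : {subset cols T <= unzip1 p.1}.
  move=> i; rewrite -mem_attrs => iT; apply/negPn/negP => ip.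
  have [r' [r'T /neq r'r er']] := nT i iT.
  have r'p : r' \in rows (subtable T p.1).
    move: rp; rewrite !mem_subtable r'T rT /= => /allP h.
    apply/allP => x xp; rewrite -(eqP (h x xp)); apply/eqP.
    have xi : x.1 != i by apply: contraNneq ip => <-; exact: map_f.
    have [xT|xT] := boolP (x.1 \in attrs T); first exact: er'.
    (* A label outside [attrs T] gives the default [None] on both rows. *)
    have le : W T <= index x.1 (cols T) by rewrite leqNgt index_mem -mem_attrs.
    by rewrite /value !onth_default ?(rows_size rT) ?(rows_size r'T).
  by apply/r'r/dT; rewrite -(decs_subtable r'p); exact: one.
apply: (leq_trans (uniq_leq_size (cols_uniq T) sub)).
by rewrite size_map; exact: (@leq_bigmax_seq _ _ xpredT (fun q : cpath k => size q.1) p pG).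
Qed.

Lemma closure1_hs T r D : r \in rows T -> (D `<=` attrs T)%fset ->
  has_neighbours T r D ->
  exists T', [/\ closure1 T T', W T' = #|` D|%fset & #|` D|%fset <= hs T'].
Proof.
(* For empty [D] all columns are deleted, which yields [Lambda]; [I_opE] needs a surviving
   column. *)
move=> rT DT nD; have [->|/fset0Pn[i0 i0D]] := eqVneq D fset0.
  exists (Lambda k); split; rewrite ?cardfs0 //.
  exists (attrs T) => //; exists (fun=> ord0); apply/esym/Lambda_uniq.
  have [_ e] := @J_opE k (I_op (attrs T) T) (fun=> ord0).
  by rewrite /rows e /= I_op_all.
pose E := (attrs T `\` D)%fset.
have nE : ~~ (attrs T `<=` E)%fset.
  apply/fsubsetPn; exists i0; first exact: (fsubsetP DT).
  by rewrite in_fsetD i0D.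
have DE i : i \in D -> i \notin E by move=> iD; rewrite in_fsetD iD.
have [cE dE] := I_opE nE.
pose s := proj E T r.
(* The minimum decisions chosen by [I_op] are overwritten: only the projection of [r] gets 1. *)
pose nu (t : (W (I_op E T)).-tuple 'I_k) : 'I_2 :=
  if val t == s then ord_max else ord0.
have [cJ dJ] := J_opE nu.
have rE r' : r' \in rows T -> proj E T r' \in rows (J_op nu).
  move=> r'T; rewrite /rows dJ /= /rows dE /=.
  by apply/imfsetP; exists r'.
have aJ : attrs (J_op nu) = D.
  apply/fsetP => i; rewrite mem_attrs cJ cE mem_filter -mem_attrs in_fsetD.
  have [iD|iD] := boolP (i \in D); first by rewrite (fsubsetP DT).
  by case: (i \in attrs T).
have WJ : W (J_op nu) = #|` D|%fset.
  by rewrite -aJ /attrs card_fseq undup_id // cols_uniq.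
exists (J_op nu); split=> //.
  by exists E; [exact: fsubsetDl | exists nu].
rewrite -WJ; apply: (@W_le_hs _ s); rewrite ?WJ ?aJ.
- by rewrite cardfs_gt0; apply/fset0Pn; exists i0.
- exact: rE.
- have dJE r' : r' \in rows (J_op nu) ->
      ((decs (J_op nu)).[? r'] = Some (if r' == s then ord_max else ord0))%fmap.
    move=> r'J; have sr' : size r' == W (I_op E T).
      by rewrite (rows_size r'J) /W cJ.
    rewrite dJ; move: r'J; rewrite /rows dJ => r'J.
    by rewrite (in_fnd r'J) ffunE /= insubT.
  move=> r'; split=> [e|->]; last by rewrite dJE ?rE // eqxx.
  have r'J : r' \in rows (J_op nu) by rewrite /rows -fndSome e.
  by move: e; rewrite dJE //; case: eqP.
- have vJ r' i : r' \in rows T -> i \in D ->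
      value (J_op nu) (proj E T r') i = value T r' i.
    by move=> r'T /DE iE; rewrite -(value_proj r'T iE nE) /value cJ.
  move=> i iD; have [r' [r'T ne e]] := nD i iD.
  exists (proj E T r'); split; first exact: rE.
    by rewrite !vJ.
  by move=> j jD ji; rewrite !vJ // e.
Qed.

End Neighbours.

Theorem theorem8 (k : nat) (hk : 2 <= k) (A : set (table k))
    (hA : closed_class A)
    (hS : ~ exists m : nat, forall T : table k, A T -> Smax T <= m) (n : nat) :
  Gh A n = n.
Proof.
have [[T [_ WT] hT] maxG] := Gh_attained n hA.
(* The upper bound holds in any table: a tree may read each row with decision 1 in full. *)
apply/eqP; rewrite eqn_leq -{1}hT (leq_trans (hs_leW T) WT) /=.
have [T0 AT0 nT0] : exists2 T0, A T0 & n < Smax T0.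
  apply: contrapT => no; apply: hS; exists n => T0 AT0; rewrite leqNgt.
  by apply/negP => nT0; apply: no; exists T0.
have [r [D [rT DT cD nD]]] := Smax_neighbours nT0.
have [T' [cT' WT' hT']] := closure1_hs rT DT nD; rewrite cD in WT' hT'.
apply: leq_trans hT' (maxG T' _ _); last by rewrite WT'.
(* [T'] belongs to [A] because [A] is closed. *)
by have [_ <-] := hA; exists T0.
Qed.
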